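(* Let $f:\mathbb{R}^2\to\mathbb{R}$ be a lower semicontinuous function. Then $$\mathcal{L}^1\left(f\left(\{x\in\mathbb{R}^2: 0\in\partial_P f(x)\}\right)\right)=0.$$
   Context: $\mathcal{L}^1$ denotes Lebesgue outer measure on $\mathbb{R}$. For a lower semicontinuous function $f:\mathbb{R}^d\to(-\infty,\infty]$ and a point $x$ with $f(x)<\infty$, the proximal subdifferential $\partial_P f(x)$ is the set of all $\zeta\in\mathbb{R}^d$ for which there exist $\sigma,\eta>0$ such that $$f(y)\geq f(x)+\langle\zeta,y-x\rangle-\sigma|y-x|^2\quad\text{for all }y\in B(x,\eta).$$ *)

(* Defs.v *)
From HB Require Import structures.
From mathcomp Require Import all_boot all_order all_algebra.
From mathcomp Require Import all_classical all_reals all_analysis.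

Set Implicit Arguments.
Unset Strict Implicit.
Unset Printing Implicit Defensive.

Import Order.TTheory GRing.Theory Num.Theory.
Import numFieldNormedType.Exports.

Local Open Scope classical_set_scope.
Local Open Scope ring_scope.

Definition inner (R : realType) (d : nat) (u v : 'rV[R]_d) : R :=
  \sum_(i < d) u ord0 i * v ord0 i.

(* The library norm on ['rV[R]_d] is the sup norm; its topology is the usual
   one, but the Euclidean norm has to be introduced separately. *)
Definition enorm (R : realType) (d : nat) (u : 'rV[R]_d) : R :=
  Num.sqrt (inner u u).

(* [f] is meant to take values in (-oo, +oo]. The set is empty where f x = +oo. *)
Definition proximal_subdifferential (R : realType) (d : nat)
    (f : 'rV[R]_d -> \bar R) (x : 'rV[R]_d) : set 'rV[R]_d :=
  [set zeta | (f x < +oo)%E /\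
    exists sigma eta : R, [/\ 0 < sigma, 0 < eta &
      forall y : 'rV[R]_d, enorm (y - x) < eta ->
        (f x + (inner zeta (y - x))%:E - (sigma * enorm (y - x) ^+ 2)%:E
           <= f y)%E]].

(* The outer measure, on all sets of reals, generated by b - a on the intervals
   ]a, b]; [lebesgue_measure] is this same function. *)
Definition lebesgue_outer_measure (R : realType) : set R -> \bar R :=
  ((@wlength R idfun)^*)%mu.

(* Main.v *)
(* Fix n and let A be the set of points x at which the proximal inequality
   f y >= f x - n |y - x|^2 holds for |y - x| < 1/n.  On a part E of A of diameter
   less than 1/n, exchanging x and y gives |f x - f y| <= n |x - y|^2.
   Suppose K is such that the outer measure of f (E `&` Q) is at most K s^2 for
   every square Q of side s; K = 16 n will do.  Cut Q into N^2 equal cells.  If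
   all of them meet E, two points of E `&` Q are joined by a chain of O(N) points
   of E lying in adjacent cells, so f (E `&` Q) has diameter O(n s^2 / N).
   Otherwise one cell contributes nothing, and summing over the others gives the
   bound K (1 - 1/N^2) s^2.  Hence K can be replaced by
   max (O(n / N), K (1 - 1/N^2)) for every N, so the infimum of the admissible K
   is 0 and f (E `&` Q) is null. *)
Require Import Defs.
From HB Require Import structures.
From mathcomp Require Import all_boot all_order all_algebra.
From mathcomp Require Import all_classical all_reals all_analysis.
From mathcomp Require Import ring lra zify.
Set Implicit Arguments.
Unset Strict Implicit.
Unset Printing Implicit Defensive.

Import Order.TTheory GRing.Theory Num.Theory.
Import numFieldNormedType.Exports.
Local Open Scope classical_set_scope.
Local Open Scope ring_scope.

(** * Outer measure, squares and cells *)

HB.instance Definition _ (R : realType) :=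
  OuterMeasure.copy (@lebesgue_outer_measure R) ((@wlength R idfun)^*)%mu.

(** The set lies in the closed interval of radius [D] about any one of its points, whence the factor
    2. *)
Lemma outer_measure_le_diam (R : realType) (S : set R) (D : R) : 0 <= D ->
  (forall u v, S u -> S v -> `|u - v| <= D) ->
  (lebesgue_outer_measure S <= (2 * D)%:E)%E.
Proof.
move=> D0 hS; have [->|/set0P[u Su]] := eqVneq S set0.
  by rewrite outer_measure0 lee_fin mulr_ge0.
apply: (@le_trans _ _ (lebesgue_outer_measure `[u - D, u + D]%classic)).
  apply: le_outer_measure => v Sv; rewrite /= in_itv /=.
  by have := hS _ _ Su Sv; rewrite ler_distlC.
rewrite -[X in (X <= _)%E]/(lebesgue_measure _) lebesgue_measure_itv /=.
case: ifP => _; last by rewrite lee_fin; lra.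
by rewrite -EFinB lee_fin; lra.
Qed.

(** Half-open, so that the cells of a grid tile a square and the squares of a mesh tile the
    plane. *)
Definition square (R : realType) (a b s : R) : set 'rV[R]_2 :=
  [set x | a <= x 0 0 < a + s /\ b <= x 0 1 < b + s].

Definition cell (R : realType) (a b h : R) (i j : nat) : set 'rV[R]_2 :=
  square (a + i%:R * h) (b + j%:R * h) h.

Lemma enorm_sq2 (R : realType) (u : 'rV[R]_2) :
  enorm u ^+ 2 = u 0 0 ^+ 2 + u 0 1 ^+ 2.
Proof.
have E : inner u u = u 0 0 ^+ 2 + u 0 1 ^+ 2.
  rewrite /inner big_ord_recl big_ord1 !expr2.
  by rewrite (_ : lift ord0 ord0 = 1) //; apply/val_inj.
by rewrite /enorm E sqr_sqrtr // addr_ge0 // sqr_ge0.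
Qed.

Lemma truncn_cell (R : realType) (a h t : R) (N : nat) : 0 < h ->
  a <= t < a + N%:R * h ->
  exists2 i : nat, (i < N)%N & a + i%:R * h <= t < a + i%:R * h + h.
Proof.
move=> h0 /andP[at_ tN].
have q0 : 0 <= (t - a) / h by rewrite divr_ge0 ?subr_ge0 // ltW.
have /andP[t1 t2] := truncn_itv q0.
exists (Num.truncn ((t - a) / h)).
  rewrite -(ltr_nat R); apply: le_lt_trans t1 _.
  by rewrite ltr_pdivrMr //; lra.
move: t1 t2; rewrite ler_pdivlMr // ltr_pdivrMr // -natr1 => t1 t2.
by apply/andP; split; lra.
Qed.

Lemma square_cover (R : realType) (a b h : R) (N : nat) x : 0 < h ->
  square a b (N%:R * h) x ->
  exists i j, [/\ (i < N)%N, (j < N)%N & cell a b h i j x].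
Proof.
move=> h0 [/(truncn_cell h0)[i iN xi] /(truncn_cell h0)[j jN xj]].
by exists i, j.
Qed.

(** * Oscillation under a quadratic bound *)

Definition quadratic_on (R : realType) (C : R) (g : 'rV[R]_2 -> R)
    (E : set 'rV[R]_2) :=
  forall x y, E x -> E y -> `|g x - g y| <= C * enorm (x - y) ^+ 2.

Lemma sqr_le_sqr4 (R : realType) (t h : R) : - (2 * h) <= t <= 2 * h ->
  t ^+ 2 <= 4 * h ^+ 2.
Proof. by nra. Qed.

(** Points in equal or adjacent cells of side [h], diagonal neighbours included, differ by at most
    [2 * h] in each coordinate, so their squared distance is at most [8 * h ^+ 2]. *)
Lemma quadratic_step (R : realType) (C h : R) g E x y :
  0 <= C -> quadratic_on C g E -> E x -> E y ->
  - (2 * h) <= x 0 0 - y 0 0 <= 2 * h -> - (2 * h) <= x 0 1 - y 0 1 <= 2 * h ->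
  `|g x - g y| <= 8 * C * h ^+ 2.
Proof.
move=> C0 gE Ex Ey /sqr_le_sqr4 d0 /sqr_le_sqr4 d1.
apply: le_trans (gE _ _ Ex Ey) _.
rewrite enorm_sq2 !mxE (mulrC 8) -mulrA ler_wpM2l //; lra.
Qed.

(** Induction on [i + j]: walk to the corner cell through points of [E], one per cell. The extra
    unit in [k.+1] pays for the last step, inside the corner cell. *)
Lemma quadratic_chain (R : realType) (C h a b : R) g E (N : nat) :
  0 <= C -> 0 < h -> quadratic_on C g E ->
  (forall i j, (i < N)%N -> (j < N)%N -> E `&` cell a b h i j !=set0) ->
  forall k i j x y, (i < N)%N -> (j < N)%N -> (i + j = k)%N ->
  E x -> cell a b h i j x -> E y -> cell a b h 0 0 y ->
  `|g x - g y| <= k.+1%:R * (8 * C * h ^+ 2).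
Proof.
move=> C0 h0 gE ne; elim => [|k IH] i j x y iN jN ijk Ex cx Ey cy.
  move: ijk cx => /eqP; rewrite addn_eq0 => /andP[/eqP -> /eqP ->] cx.
  rewrite mul1r; apply: (quadratic_step C0 gE) => //.
    by case: cx cy => [xi _] [yi _]; lra.
  by case: cx cy => [_ xj] [_ yj]; lra.
(* The next cell lowers [i] if it is positive, and [j] otherwise. *)
have [i' [j' [i'N j'N ijk' hi hj]]] : exists i' j', [/\ (i' < N)%N, (j' < N)%N,
    (i' + j' = k)%N, (i' <= i <= i'.+1)%N & (j' <= j <= j'.+1)%N].
  case: i iN ijk {cx} => [|i] iN ijk; last by exists i, j; split; lia.
  by exists 0%N, j.-1; split; lia.
have [z [Ez cz]] := ne _ _ i'N j'N.
rewrite -natr1 mulrDl mul1r [leRHS]addrC.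
apply: le_trans (ler_distD (g z) _ _) _; apply: lerD; last first.
  exact: (IH i' j').
have near (p q : nat) : (q <= p <= q.+1)%N ->
    q%:R * h <= p%:R * h <= q%:R * h + h.
  move=> /andP[qp pq]; rewrite -[X in _ <= _ <= _ + X]mul1r -mulrDl natr1.
  by apply/andP; split; rewrite ler_wpM2r ?ler_nat // ltW.
have /andP[ni1 ni2] := near _ _ hi; have /andP[nj1 nj2] := near _ _ hj.
apply: (quadratic_step C0 gE) => //.
  by case: cx cz => [xi _] [zi _]; lra.
by case: cx cz => [_ xj] [_ zj]; lra.
Qed.

Lemma quadratic_full_square (R : realType) (C h a b : R) g E (N : nat) :
  0 <= C -> 0 < h -> (0 < N)%N -> quadratic_on C g E ->
  (forall i j, (i < N)%N -> (j < N)%N -> E `&` cell a b h i j !=set0) ->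
  (lebesgue_outer_measure (g @` (E `&` square a b (N%:R * h)))
    <= (64 * C * N%:R * h ^+ 2)%:E)%E.
Proof.
move=> C0 h0 N0 gE ne.
have ch2 : 0 <= 8 * C * h ^+ 2 by rewrite mulr_ge0 ?sqr_ge0 // mulr_ge0.
have [z [Ez cz]] := ne _ _ N0 N0.
have toz x : E x -> square a b (N%:R * h) x ->
    `|g x - g z| <= (2 * N%:R) * (8 * C * h ^+ 2).
  move=> Ex /(square_cover h0)[i [j [iN jN cx]]].
  apply: le_trans (quadratic_chain C0 h0 gE ne iN jN erefl Ex cx Ez cz) _.
  by rewrite ler_wpM2r // -natrM ler_nat; lia.
(* A chain to [z] has at most [2 * N] steps; passing through [z] doubles this for the diameter, and
   [outer_measure_le_diam] doubles it again. *)
rewrite (_ : 64 * C * N%:R * h ^+ 2 = 2 * (4 * N%:R * (8 * C * h ^+ 2)));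
  last by ring.
apply: outer_measure_le_diam; first by rewrite mulr_ge0 // mulr_ge0.
move=> _ _ [x [Ex Qx] <-] [y [Ey Qy] <-].
apply: le_trans (ler_distD (g z) _ _) _.
by have := toz _ Ex Qx; have := toz _ Ey Qy; rewrite (distrC (g y)); lra.
Qed.

(** * Measure bounds proportional to the area *)

Definition square_bound (R : realType) (g : 'rV[R]_2 -> R) (E : set 'rV[R]_2)
    (K : R) :=
  forall a b s, 0 < s ->
    (lebesgue_outer_measure (g @` (E `&` square a b s)) <= (K * s ^+ 2)%:E)%E.

(** Since [square_bound] is uniform in position and side, it applies to each of the [N * N - 1]
    remaining cells. *)
Lemma square_bound_nonfull (R : realType) (K h a b : R) g E (N i0 j0 : nat) :
  0 <= K -> 0 < h -> square_bound g E K -> (i0 < N)%N -> (j0 < N)%N ->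
  E `&` cell a b h i0 j0 = set0 ->
  (lebesgue_outer_measure (g @` (E `&` square a b (N%:R * h)))
    <= (K * (N%:R ^+ 2 - 1) * h ^+ 2)%:E)%E.
Proof.
move=> K0 h0 gK iN jN e0.
(* A single index [k = i * N + j] enumerates the cells. *)
pose F k := g @` (E `&` cell a b h (k %/ N) (k %% N)).
have k0N : (i0 * N + j0 < N * N)%N by nia.
apply: (@le_trans _ _ (\sum_(k < N * N) lebesgue_outer_measure (F k))%E).
  apply: le_trans _ (outer_measure_subadditive _ F _).
  apply: le_outer_measure => y [x [Ex /(square_cover h0)]].
  move=> [i [j [iN' jN' cx]]] <-; rewrite -bigcup_mkord.
  exists (i * N + j)%N => /=; first by nia.
  exists x => //; split => //.
  by rewrite divnMDl ?modnMDl ?divn_small ?addn0 ?modn_small //; lia.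
rewrite (bigD1 (Ordinal k0N)) //= {1}/F divnMDl ?modnMDl; last by lia.
rewrite divn_small // addn0 modn_small // e0 image_set0 outer_measure0 add0e.
apply: (@le_trans _ _ (\sum_(k < N * N | k != Ordinal k0N) (K * h ^+ 2)%:E)%E).
  by apply: lee_sum => k _; exact: gK.
rewrite sumEFin lee_fin sumr_const.
have -> : #|[pred k | k != Ordinal k0N]| = (N * N).-1.
  by rewrite cardC1 card_ord.
rewrite -subn1 -[leLHS]mulr_natr natrB ?natrM; last by nia.
by rewrite expr2; lra.
Qed.

Lemma square_bound_improve (R : realType) (C K : R) g E (N : nat) :
  0 <= C -> 0 <= K -> quadratic_on C g E -> (0 < N)%N -> square_bound g E K ->
  square_bound g E (Num.max (64 * C / N%:R) (K * (1 - N%:R ^- 2))).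
Proof.
move=> C0 K0 gE N0 gK a b s s0.
have n0 : (N%:R : R) != 0 by rewrite pnatr_eq0; lia.
pose h := s / N%:R.
have h0 : 0 < h by rewrite divr_gt0 // ltr0n.
have sE : s = N%:R * h by rewrite /h; field.
case: (pselect (forall i j, (i < N)%N -> (j < N)%N ->
    E `&` cell a b h i j !=set0)) => [ne|nne].
  rewrite sE; apply: le_trans (quadratic_full_square C0 h0 N0 gE ne) _.
  rewrite lee_fin.
  have -> : 64 * C * N%:R * h ^+ 2 = 64 * C / N%:R * (N%:R * h) ^+ 2 by field.
  by rewrite ler_wpM2r ?sqr_ge0 // le_max lexx.
have [i [j [iN jN e0]]] : exists i j, [/\ (i < N)%N, (j < N)%N &
    E `&` cell a b h i j = set0].
  apply: contrapT => no; apply: nne => i j iN jN; apply/set0P/eqP => e0.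
  by apply: no; exists i, j.
rewrite sE; apply: le_trans (square_bound_nonfull K0 h0 gK iN jN e0) _.
rewrite lee_fin.
have -> : K * (N%:R ^+ 2 - 1) * h ^+ 2 =
  K * (1 - N%:R ^- 2) * (N%:R * h) ^+ 2 by field.
by rewrite ler_wpM2r ?sqr_ge0 // le_max lexx orbT.
Qed.

(** Provides an admissible constant, so that the infimum of all of them makes sense. *)
Lemma square_bound_init (R : realType) (C : R) g E :
  0 <= C -> quadratic_on C g E -> square_bound g E (16 * C).
Proof.
move=> C0 gE a b s s0.
rewrite (_ : 16 * C * s ^+ 2 = 2 * (8 * C * s ^+ 2)); last by ring.
apply: outer_measure_le_diam; first by rewrite mulr_ge0 ?sqr_ge0 // mulr_ge0.
move=> _ _ [x [Ex [x0 x1]] <-] [y [Ey [y0 y1]] <-].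
by apply: (quadratic_step C0 gE) => //; lra.
Qed.

Lemma square_bound_arbitrarily_small (R : realType) (C : R) g E :
  0 <= C -> quadratic_on C g E ->
  forall e, 0 < e -> exists2 K, 0 <= K < e & square_bound g E K.
Proof.
move=> C0 gE e e0.
pose S := [set K : R | 0 <= K /\ square_bound g E K].
have Sinf : has_inf S.
  split; last by exists 0 => K [].
  by exists (16 * C); split; [rewrite mulr_ge0|exact: square_bound_init].
have lbS : has_lbound S by case: Sinf.
suff k0 : inf S <= 0.
  have [K [K0 gK] Ke] := inf_lt Sinf.1 (le_lt_trans k0 e0).
  by exists K; rewrite ?K0.
rewrite leNgt; apply/negP => k0.
set k := inf S in k0 *.
(* [2 <= N] keeps the factor [1 - N%:R ^- 2] strictly between 0 and 1. *)
have [N N2 Nk] : exists2 N, (2 <= N)%N & 64 * C / N%:R < k.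
  pose M := Num.bound (64 * C / k).
  have hM : 64 * C / k < M%:R.
    by apply: archi_boundP; rewrite divr_ge0 ?mulr_ge0 // ltW.
  exists M.+2 => //; rewrite ltr_pdivrMr ?ltr0n // [ltRHS]mulrC -ltr_pdivrMr //.
  by apply: lt_le_trans hM _; rewrite ler_nat; lia.
have q0 : 0 < 1 - (N%:R : R) ^- 2 < 1.
  have N4 : (4 : R) <= N%:R ^+ 2 by rewrite -natrX ler_nat; nia.
  have Nv : 0 < (N%:R : R) ^- 2 by rewrite invr_gt0; lra.
  have : (N%:R : R) ^- 2 < 1 by rewrite invf_lt1; lra.
  by lra.
have /andP[qp q1] := q0.
(* An admissible [K] below this quotient improves to a constant below the infimum [k], a
   contradiction. *)
have kq : k < k / (1 - N%:R ^- 2).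
  by rewrite ltr_pdivlMr // -[ltRHS]mulr1 ltr_pM2l.
have [K [K0 gK]] := inf_lt Sinf.1 kq; rewrite ltr_pdivlMr // => Kk.
have /(ge_inf lbS) : S (Num.max (64 * C / N%:R) (K * (1 - N%:R ^- 2))).
  split; first by rewrite le_max (mulr_ge0 K0 (ltW qp)) orbT.
  by apply: square_bound_improve => //; lia.
by rewrite leNgt gt_max Nk Kk.
Qed.

Lemma quadratic_square_null (R : realType) (C : R) g E a b s :
  0 <= C -> 0 < s -> quadratic_on C g E ->
  lebesgue_outer_measure (g @` (E `&` square a b s)) = 0%E.
Proof.
move=> C0 s0 gE; apply/eqP; rewrite eq_le outer_measure_ge0 andbT.
apply/lee_addgt0Pr => e e0; rewrite add0e.
have es : 0 < e / s ^+ 2 by rewrite divr_gt0 // exprn_gt0.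
have [K /andP[K0 Ke] gK] := square_bound_arbitrarily_small C0 gE es.
apply: le_trans (gK a b s s0) _.
by rewrite lee_fin -ler_pdivlMr ?exprn_gt0 // ltW.
Qed.

(** * Countable decomposition *)

Lemma outer_measure_null_bigcup (R : realType) (T : countType) (A : set R)
    (F : T -> set R) : A `<=` \bigcup_t F t ->
  (forall t, lebesgue_outer_measure (F t) = 0%E) ->
  lebesgue_outer_measure A = 0%E.
Proof.
move=> AF F0; apply/eqP; rewrite eq_le outer_measure_ge0 andbT.
pose G n := if unpickle n is Some t then F t else set0.
have AG : A `<=` \bigcup_n G n.
  by move=> x /AF[t _ Ft]; exists (pickle t) => //; rewrite /G pickleK.
apply: le_trans (le_outer_measure _ _ _ AG) _.
apply: le_trans (outer_measure_sigma_subadditive _ _) _.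
rewrite eseries0 // => n _ _; rewrite /G.
by case: unpickle => [t|]; [exact: F0|exact: outer_measure0].
Qed.

Theorem theorem1p7 (R : realType) (f : 'rV[R]_2 -> R)
    (hf : lower_semicontinuous (EFin \o f)) :
  lebesgue_outer_measure
    (f @` [set x : 'rV[R]_2 | proximal_subdifferential (EFin \o f) x 0]) = 0%E.
Proof.
pose A (n : nat) := [set x : 'rV[R]_2 | forall y, enorm (y - x) < n.+1%:R^-1 ->
  f x - n.+1%:R * enorm (y - x) ^+ 2 <= f y].
(* Half the radius in [A n]: the diagonal of a square of this side is then shorter than that
   radius. *)
pose s (n : nat) : R := (2 * n.+1%:R)^-1.
have s0 n : 0 < s n by rewrite invr_gt0 mulr_gt0 ?ltr0n.
pose Q (t : nat * int * int) :=
  square (t.1.2%:~R * s t.1.1) (t.2%:~R * s t.1.1) (s t.1.1).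
have enormN (u : 'rV[R]_2) : enorm (- u) = enorm u.
  by congr Num.sqrt; apply: eq_bigr => i _; rewrite !mxE mulrNN.
have quad n a b : quadratic_on n.+1%:R f (A n `&` square a b (s n)).
  move=> x y [Ax [x0 x1]] [Ay [y0 y1]].
  have xy : enorm (x - y) < n.+1%:R^-1.
    have sn : n.+1%:R^-1 = 2 * s n by rewrite /s invfM mulrA mulfV ?mul1r.
    rewrite -(ltr_pXn2r (n := 2)) ?nnegrE ?sqrtr_ge0 ?invr_ge0 ?ler0n //.
    by rewrite sn enorm_sq2 !mxE; have := s0 n; nra.
  have := Ay _ xy; have := Ax y; rewrite -opprB enormN => /(_ xy).
  by rewrite ler_norml; lra.
(* The first [Q t] makes the quadratic bound hold; the second matches the form of
   [quadratic_square_null]. *)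
pose F t := f @` ((A t.1.1 `&` Q t) `&` Q t).
apply: (@outer_measure_null_bigcup _ _ _ F); last first.
  by move=> [[n i] j]; apply: quadratic_square_null (quad n _ _); rewrite ?ler0n.
move=> _ [x [_ [sigma [eta [sg0 et0 hx]]]] <-].
(* With [n.+1] above both [sigma] and [eta^-1], the proximal inequality at [x] implies the one
   defining [A n]. *)
pose n := maxn (Num.bound sigma) (Num.bound eta^-1).
have sn : sigma <= n.+1%:R.
  apply: ltW; apply: lt_le_trans (archi_boundP (ltW sg0)) _.
  by rewrite ler_nat /n; lia.
have en : n.+1%:R^-1 <= eta.
  rewrite -[leRHS]invrK lef_pV2 ?posrE ?invr_gt0 ?ltr0n //.
  apply: ltW; apply: lt_le_trans (archi_boundP _) _; first by rewrite invr_ge0 ltW.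
  by rewrite ler_nat /n; lia.
have inQ (t : R) :
    (Num.floor (t / s n))%:~R * s n <= t < (Num.floor (t / s n))%:~R * s n + s n.
  have /andP[t1 t2] := floor_itv (t / s n).
  move: t1 t2; rewrite ler_pdivlMr // ltr_pdivrMr // intrD mulrDl mul1r => -> ->.
  by [].
pose t := (n, Num.floor (x 0 0 / s n), Num.floor (x 0 1 / s n)).
have Qx : Q t x by split; apply: inQ.
exists t => //; exists x => //; split => //; split => //= y xy.
have := hx y (lt_le_trans xy en).
have -> : inner 0 (y - x) = 0.
  by rewrite /inner big1 // => i _; rewrite mxE mul0r.
rewrite /= adde0 -EFinB lee_fin; apply: le_trans.
by rewrite lerD2l lerN2 ler_wpM2r ?sqr_ge0.
Qed.
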